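(* Let $\mathcal{H}$ be a real Hilbert space and let $f,g\in\Gamma_0(\mathcal{H})$. Assume that strong duality holds, i.e. $\inf_{x\in\mathcal{H}}\big(f(x)+g(x)\big)=\sup_{\nu\in\mathcal{H}}\big(-f^*(\nu)-g^*(-\nu)\big)$. Define $F(x,\nu)=f(x)+f^*(\nu)$ and $G(x,\nu)=g(x)+g^*(-\nu)$ on $\mathcal{H}\times\mathcal{H}$, and let $(x,\nu,\tau)\in\mathcal{H}\times\mathcal{H}\times[0,+\infty[$ satisfy $$\widetilde{F}(x,\nu,\tau)+\widetilde{G}(x,\nu,\tau)\le 0 .\qquad(\ast)$$ Then the following hold. (i) If $\tau>0$, then $(\ast)$ holds with equality, $x/\tau$ is a minimizer of $f+g$ over $\mathcal{H}$ (with $x/\tau\in\operatorname{dom}f\cap\operatorname{dom}g$), $\nu/\tau$ is a maximizer of $\nu'\mapsto -f^*(\nu')-g^*(-\nu')$ over $\mathcal{H}$ (with $\nu/\tau\in\operatorname{dom}f^*\cap(-\operatorname{dom}g^* )$), and the duality gap vanishes: $f(x/\tau)+g(x/\tau)+f^*(\nu/\tau)+g^*(-\nu/\tau)=0$. (ii) If $(\ast)$ holds with strict inequality, then $\tau=0$ and at least one of the following two inequalities holds: $$\text{(a)}\ \ (\operatorname{rec}f^* )(\nu)+(\operatorname{rec}g^* )(-\nu)<0,\qquad \text{(b)}\ \ (\operatorname{rec}f)(x)+(\operatorname{rec}g)(x)<0 .$$ (iii) If (a) holds, then $\sup_{u\in\operatorname{dom}f}\langle u\mid\nu\rangle<\inf_{z\in\operatorname{dom}g}\langle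 z\mid\nu\rangle$, so $\operatorname{dom}f$ and $\operatorname{dom}g$ are strongly separated by a hyperplane with normal $\nu$ and $\operatorname{dom}f\cap\operatorname{dom}g=\emptyset$ (the primal problem is infeasible). If (b) holds, then $\sup_{\mu\in\operatorname{dom}f^*}\langle\mu\mid x\rangle<\inf_{\lambda\in-\operatorname{dom}g^*}\langle\lambda\mid x\rangle$, so $\operatorname{dom}f^*$ and $-\operatorname{dom}g^*$ are strongly separated by a hyperplane with normal $x$ (and hence $\operatorname{dom}f^*\cap(-\operatorname{dom}g^* )=\emptyset$: the dual problem is infeasible).
   Context: $\Gamma_0(\mathcal{H})$ is the set of proper lower semicontinuous convex functions $\mathcal{H}\to\left]-\infty,+\infty\right]$. For $h\in\Gamma_0(\mathcal{H})$: $\operatorname{dom}h=\{x\mid h(x)<+\infty\}$; $h^*(u)=\sup_{x}(\langle x\mid u\rangle-h(x))$ is the Fenchel conjugate; $(\operatorname{rec}h)(y)=\sup_{x\in\operatorname{dom}h}(h(x+y)-h(x))$ is the recession function; and the perspective function $\widetilde{h}:\mathcal{H}\times\mathbb{R}\to\left]-\infty,+\infty\right]$ is $\widetilde{h}(x,\tau)=\tau h(x/\tau)$ if $\tau>0$, $(\operatorname{rec}h)(x)$ if $\tau=0$, and $+\infty$ if $\tau<0$. For $F,G$, which belong to $\Gamma_0(\mathcal{H}\times\mathcal{H})$, the perspectives $\widetilde F,\widetilde G$ are functions of $((x,\nu),\tau)$, written $(x,\nu,\tau)$. The primal problem is to minimize $f(x)+g(x)$ over $x\in\mathcal{H}$;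 its Fenchel dual is to maximize $-f^*(\nu)-g^*(-\nu)$ over $\nu\in\mathcal{H}$. *)

(* Defs.v *)
From HB Require Import structures.
From mathcomp Require Import all_boot all_order all_algebra.
From mathcomp Require Import sesquilinear.
From mathcomp Require Import all_classical all_reals ereal topology normedtype.

Set Implicit Arguments.
Unset Strict Implicit.
Unset Printing Implicit Defensive.

Import Order.TTheory GRing.Theory Num.Theory.
Import numFieldNormedType.Exports.

Local Open Scope classical_set_scope.
Local Open Scope ring_scope.
Local Open Scope ereal_scope.

(* A real Hilbert space is a complete normed module [H] over a [realType]
   together with a positive definite symmetric form that induces its norm. *)
Definition induces_norm (R : realType) (H : completeNormedModType R)
    (ip : {dot H for idfun}) : Prop :=
  forall x : H, (`|x| ^+ 2 = ip x x)%R.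

Definition dom (R : realType) (T : Type) (h : T -> \bar R) : set T :=
  [set x | h x < +oo].

Definition proper_fun (R : realType) (T : Type) (h : T -> \bar R) : Prop :=
  (forall x, h x != -oo) /\ dom h !=set0.

(* Restricting to [0 < t < 1] avoids the products [0 * +oo]. *)
Definition convex_efun (R : realType) (E : lmodType R) (h : E -> \bar R)
    : Prop :=
  forall (x y : E) (t : R), (0 < t < 1)%R ->
    h (t *: x + (1 - t) *: y)%R <= t%:E * h x + (1 - t)%:E * h y.

Definition Gamma0 (R : realType) (H : normedModType R) (h : H -> \bar R)
    : Prop :=
  [/\ proper_fun h, lower_semicontinuous h & convex_efun h].

Definition conjugate (R : realType) (H : lmodType R) (ip : H -> H -> R)
    (h : H -> \bar R) (u : H) : \bar R :=
  ereal_sup [set (ip x u)%:E - h x | x in [set: H]].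

Definition recession (R : realType) (E : lmodType R) (h : E -> \bar R) (y : E)
    : \bar R :=
  ereal_sup [set h (x + y)%R - h x | x in dom h].

Definition perspective (R : realType) (E : lmodType R) (h : E -> \bar R)
    (p : E * R) : \bar R :=
  if (0 < p.2)%R then p.2%:E * h (p.2^-1 *: p.1)%R
  else if p.2 == 0%R then recession h p.1
  else +oo.

Definition is_minimizer (R : realType) (T : Type) (h : T -> \bar R) (x : T)
    : Prop :=
  forall y, h x <= h y.

Definition is_maximizer (R : realType) (T : Type) (h : T -> \bar R) (x : T)
    : Prop :=
  forall y, h y <= h x.

(* The hyperplane is [ip z u = c], and both sets stay at a positive distance
   from it, [C] on the negative side and [D] on the positive side. *)
Definition strongly_separated (R : realType) (H : lmodType R)
    (ip : H -> H -> R) (u : H) (C D : set H) : Prop :=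
  u != 0%R /\
  exists c : R, ereal_sup [set (ip z u)%:E | z in C] < c%:E /\
                c%:E < ereal_inf [set (ip z u)%:E | z in D].

(* Main.v *)
Require Import Defs.
From HB Require Import structures.
From mathcomp Require Import all_boot all_order all_algebra.
From mathcomp Require Import ring lra.
From mathcomp Require Import sesquilinear.
From mathcomp Require Import all_classical all_reals ereal topology normedtype.

(** The Fenchel-Young inequalities at [(xt, nut)] and [(xt, - nut)] add up to
    weak duality, whose lower bound 0 on the gap meets the assumed upper bound
    when [0 < tau]. For [tau = 0] the recession function of a separable sum
    dominates the sum of the recession functions, so one of the two pairs must
    have a negative sum. Each pair then separates domains, because the recession
    function of [h] majorizes the support function of the domain of its
    conjugate, and conversely: feed [a + n x] into Fenchel-Young, divide by [n]
    and let [n] grow. This needs [f'] and [g'] to be proper, which comes from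
    the existence of a proximal point, a limit of minimizing sequences of
    [f + |. - x0|^2], Cauchy by the parallelogram law. *)

Set Implicit Arguments.
Unset Strict Implicit.
Unset Printing Implicit Defensive.

Import Order.TTheory GRing.Theory Num.Theory.
Import numFieldNormedType.Exports.

Local Open Scope classical_set_scope.
Local Open Scope ring_scope.
Local Open Scope ereal_scope.

(** * Proximal points of a function in [Gamma0], and points where its conjugate is finite *)

Section Hilbert.
Context (R : realType) (H : completeNormedModType R) (ip : {dot H for idfun}).
Hypothesis hip : induces_norm ip.

Lemma dotC x y : ip x y = ip y x.
Proof. by rewrite hermC /= expr0 mul1r. Qed.

(** Strong convexity of the squared distance to [w], as an equality. At [t = 1/2] it is the
    parallelogram law; as [t] tends to 0 it gives the variational inequality at a minimizer. *)
Lemma sqr_norm_conv (t : R) (y z w : H) :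
  (`|t *: y + (1 - t) *: z - w| ^+ 2 =
   t * `|y - w| ^+ 2 + (1 - t) * `|z - w| ^+ 2 - t * (1 - t) * `|y - z| ^+ 2)%R.
Proof.
have -> : (t *: y + (1 - t) *: z - w = t *: (y - w) + (1 - t) *: (z - w))%R.
  by rewrite !scalerBr addrACA -opprD -scalerDl addrCA subrr addr0 scale1r.
have -> : (y - z = (y - w) - (z - w))%R by rewrite opprB addrA subrK.
rewrite !hip; move: (y - w)%R (z - w)%R => {}y {}z.
rewrite !(linearDl, linearDr, linearNl, linearNr, linearZl_LR, linearZr_LR) /=.
rewrite (dotC z y); ring.
Qed.

Lemma sqr_normD (x y : H) :
  (`|x + y| ^+ 2 = `|x| ^+ 2 + 2 * ip x y + `|y| ^+ 2)%R.
Proof. by rewrite !hip !(linearDl, linearDr) /= (dotC y x); ring. Qed.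

Section Gamma0.
Variable (f : H -> \bar R).
Hypothesis hf : Gamma0 f.

Lemma convex_epi (x y : H) (a b t : R) : (0 < t < 1)%R ->
  f x <= a%:E -> f y <= b%:E ->
  f (t *: x + (1 - t) *: y)%R <= (t * a + (1 - t) * b)%:E.
Proof.
case: hf => _ _ cf t01 fx fy; apply: (le_trans (cf x y t t01)).
have t0 : (0 <= t)%R by lra.
have t1 : (0 <= 1 - t)%R by lra.
by rewrite [leRHS]EFinD !EFinM leeD// lee_wpmul2l ?lee_fin.
Qed.

Lemma lsc_bounded_near (x0 : H) (a : R) : a%:E < f x0 ->
  exists2 d : R, (0 < d)%R & forall y, (`|y - x0| < d)%R -> a%:E < f y.
Proof.
case: hf => _ lf _ /(lf x0 a)[V /nbhs_ballP[d /= d0 dV] Vf].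
exists d => // y yd; apply/Vf/dV; rewrite -ball_normE /=.
by rewrite distrC.
Qed.

(* Lower semicontinuity bounds [f] below near [x0]; convexity along the
   segment from [x0] to [y] spreads this bound at a linear rate. *)
Lemma linear_lower_bound (x0 : H) (a : R) : f x0 = a%:E ->
  exists2 k : R, (0 <= k)%R &
    forall y r, f y <= r%:E -> (a - 1 - k * `|y - x0| <= r)%R.
Proof.
move=> fx0; have : (a - 1)%:E < f x0 by rewrite fx0 lte_fin; lra.
case/lsc_bounded_near => d d0 near_x0.
have k0 : (0 <= 2 / d)%R by rewrite divr_ge0 // ltW.
exists (2 / d)%R => // y r fyr.
have [yd|dy] := ltP `|y - x0|%R d.
  have := lt_le_trans (near_x0 _ yd) fyr; rewrite lte_fin.
  have : (0 <= 2 / d * `|y - x0|)%R by rewrite mulr_ge0.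
  lra.
set n := `|y - x0|%R in dy *.
have n0 : (0 < n)%R by apply: lt_le_trans dy.
(* This [t] puts the convex combination of [y] and [x0] at distance [d / 2] from [x0], where [f]
   exceeds [a - 1]. Convexity then gives [a - 1 < t * r + (1 - t) * a], that is [a - t^-1 < r]. *)
pose t := (d / (2 * n))%R.
have tn : (t * n = d / 2)%R by rewrite /t; field; rewrite gt_eqF.
have t0 : (0 < t)%R by rewrite divr_gt0 // mulr_gt0.
have t1 : (t < 1)%R by nra.
have t01 : (0 < t < 1)%R by rewrite t0.
have fx0a : f x0 <= a%:E by rewrite fx0.
have zE : (t *: y + (1 - t) *: x0 - x0 = t *: (y - x0))%R.
  by rewrite scalerBl scale1r -addrA [(x0 - _ - _)%R]addrAC subrr add0r scalerBr.
have zd : (`|t *: y + (1 - t) *: x0 - x0| < d)%R.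
  by rewrite zE normrZ gtr0_norm // -/n tn; lra.
have := lt_le_trans (near_x0 _ zd) (convex_epi t01 fyr fx0a).
rewrite lte_fin => lt1.
have -> : (2 / d * n = t^-1)%R.
  by rewrite /t; field; rewrite !gt_eqF.
have : (0 < t^-1)%R by rewrite invr_gt0.
have tV : (t * t^-1 = 1)%R by rewrite divff // gt_eqF.
nra.
Qed.

Lemma prox_exists (x0 : H) (a : R) : f x0 = a%:E ->
  exists p s, f p = s%:E /\
    forall y r, f y <= r%:E -> (s + `|p - x0| ^+ 2 <= r + `|y - x0| ^+ 2)%R.
Proof.
move=> fx0; have [k k0 lbk] := linear_lower_bound fx0.
(* Ranging over real upper bounds [b] of [f y] makes the infimum of the proximal objective a real
   number. *)
pose S := [set r : R | exists y (b : R),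
    f y <= b%:E /\ r = (b + `|y - x0| ^+ 2)%R].
(* The square absorbs the linear bound, since [s ^+ 2 - k * s + k ^+ 2] is never negative. *)
have lbS : lbound S (a - 1 - k ^+ 2)%R.
  move=> _ [y [b [/lbk fyb ->]]].
  have : (0 <= `|y - x0|)%R by [].
  nra.
have infS : has_inf S.
  split; last by exists (a - 1 - k ^+ 2)%R.
  exists (a + `|x0 - x0| ^+ 2)%R; exists x0, a; by rewrite fx0.
set m := inf S.
have mS y b : f y <= b%:E -> (m <= b + `|y - x0| ^+ 2)%R.
  by move=> fyb; apply: ge_inf; [exact: infS.2|exists y, b].
have /choice[ys ysP] : forall n : nat, exists z : H * R,
    (f z.1 <= z.2%:E) /\ (z.2 + `|z.1 - x0| ^+ 2 < m + n.+1%:R^-1)%R.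
  move=> n; have : (m < m + n.+1%:R^-1)%R by rewrite ltrDl.
  rewrite -[X in (X < _)%R -> _]/(inf S).
  case/(inf_lt infS.1) => _ [y [b [fyb ->]]] lt; by exists (y, b).
pose yy n := (ys n).1.
(* The objective is at least [m] at the midpoint and below [m + N.+1%:R^-1] at both ends, which
   bounds the term [1/4 * |yy N - yy n| ^+ 2] of [sqr_norm_conv]. *)
have small N n : (N <= n)%N -> (`|yy N - yy n| ^+ 2 < 4 * N.+1%:R^-1)%R.
  move=> Nn; have [fN ltN] := ysP N; have [fn ltn] := ysP n.
  have h01 : (0 < (2^-1 : R) < 1)%R by lra.
  have := mS _ _ (convex_epi h01 fN fn).
  rewrite sqr_norm_conv -/(yy N) -/(yy n).
  have : (n.+1%:R^-1 <= N.+1%:R^-1 :> R)%R.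
    by rewrite lef_pV2 ?posrE // ler_nat.
  move: ltN ltn; rewrite -/(yy N) -/(yy n).
  by move: (N.+1%:R^-1)%R (n.+1%:R^-1)%R => eN en; lra.
have cvgy : cvg (yy @ \oo).
  apply: cauchy_cvg; apply: cauchy_exP => e e0.
  have e20 : (0 < e ^+ 2 / 4)%R by rewrite divr_gt0 // exprn_gt0.
  have [N _ Ne] := near_infty_natSinv_lt (PosNum e20).
  exists (yy N); exists N => // n /= Nn.
  rewrite -ball_normE /=.
  rewrite -(@ltr_pXn2r _ 2) ?nnegrE // ?(ltW e0) //.
  have := small N n Nn; have /= := Ne N (leqnn N).
  by move: (N.+1%:R^-1)%R => eN; lra.
set p := lim (yy @ \oo).
(* By lower semicontinuity [c] stays below [f] along the tail of the sequence. Working with real [c]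
   also covers [f p = +oo], which is excluded only afterwards. *)
have phi_p : forall c : R, c%:E < f p -> (c + `|p - x0| ^+ 2 <= m)%R.
  move=> c /lsc_bounded_near[d d0 cf].
  have : (fun n => ((ys n).2 + `|yy n - x0| ^+ 2 : R))%R @ \oo --> m.
    apply/cvgrPdist_lt => e e0.
    have [N _ Ne] := near_infty_natSinv_lt (PosNum e0).
    exists N => // n /= Nn; have [fn ltn] := ysP n; have := mS _ _ fn.
    have /= := Ne n Nn; rewrite -/(yy n) in fn ltn *.
    move: (n.+1%:R^-1)%R ltn => en ltn lte mle.
    rewrite [ltLHS]distrC.
    by rewrite ger0_norm; lra.
  have cn : (fun n => c + `|yy n - x0| ^+ 2)%R @ \oo --> (c + `|p - x0| ^+ 2)%R.
    apply: cvgD; first exact: cvg_cst.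
    rewrite expr2; under eq_fun do rewrite expr2.
    have h : (fun n => `|yy n - x0|)%R @ \oo --> `|p - x0|%R.
      by apply: cvg_norm; apply: cvgB; [exact: cvgy|exact: cvg_cst].
    exact: cvgM.
  move=> cm; apply: (ler_cvg_to cn cm).
  have /cvgrPdist_lt/(_ _ d0) := cvgy; apply: filterS => n.
  rewrite distrC => /cf cfn; have [fn _] := ysP n.
  have := lt_le_trans cfn fn; rewrite lte_fin; lra.
case: hf => -[fNoo _] _ _.
have [s fps] : exists s, f p = s%:E.
  case E: (f p) => [s| |]; [by exists s| |by have := fNoo p; rewrite E].
  have := phi_p (m + 1 - `|p - x0| ^+ 2)%R; rewrite E ltry => /(_ isT); lra.
exists p, s; split => // y r /mS; apply: le_trans.
rewrite leNgt; apply/negP => ms.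
(* The midpoint of [s] and [m - |p - x0| ^+ 2] lies below [f p] if [p] is not optimal, and then
   violates [phi_p]. *)
have := phi_p ((m + s - `|p - x0| ^+ 2) / 2)%R.
rewrite fps lte_fin; lra.
Qed.

(* The proximal point [p] of [x0] yields the subgradient [2 (x0 - p)] of [f]
   at [p], hence a point where the conjugate is finite. *)
Lemma conjugate_dom_neq0 : dom (conjugate ip f) !=set0.
Proof.
have [[fNoo [x0 fx0]] _ _] := hf.
have [a fx0a] : exists a, f x0 = a%:E.
  by case E: (f x0) => [a| |]; [exists a|move: fx0; rewrite /dom/= E|
    have := fNoo x0; rewrite E].
have [p [s [fps minp]]] := prox_exists fx0a.
have subgrad y r : f y <= r%:E -> (s + 2 * ip (y - p) (x0 - p) <= r)%R.
  move=> fyr.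
  (* Compare [p] with a point of the segment from [p] to [y] and divide by [t]; [key0] is the limit
     as [t] tends to 0. *)
  have key t : (0 < t < 1)%R ->
      (s + `|p - x0| ^+ 2 <= r + `|y - x0| ^+ 2 - (1 - t) * `|y - p| ^+ 2)%R.
    move=> t01; have fpsle : f p <= s%:E by rewrite fps.
    have := minp _ _ (convex_epi t01 fyr fpsle); rewrite sqr_norm_conv.
    case/andP: t01 => t0 t1 h; rewrite -(ler_pM2l t0); lra.
  have key0 : (s + `|p - x0| ^+ 2 + `|y - p| ^+ 2 <= r + `|y - x0| ^+ 2)%R.
    apply/ler_addgt0Pr => e e0; set q := (`|y - p| ^+ 2)%R in key *.
    have q0 : (0 <= q)%R by exact: exprn_ge0.
    (* Chosen so that [t < 1] and the error [t * q] is at most [e]. *)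
    pose t := (e / (q + e + 1))%R.
    have te : (t * (q + e + 1) = e)%R by rewrite /t divfK // gt_eqF //; lra.
    have t0 : (0 < t)%R by rewrite divr_gt0 //; lra.
    have t1 : (t < 1)%R by nra.
    have : (0 < t < 1)%R by rewrite t0.
    move/key; nra.
  have := sqr_normD (y - p)%R (p - x0)%R; rewrite addrA subrK => h.
  have -> : (x0 - p = - (p - x0))%R by rewrite opprB.
  rewrite linearNr /=; lra.
pose u := (2 *: (x0 - p))%R.
exists u; rewrite /dom /=.
apply: (@le_lt_trans _ _ (ip p u - s)%:E); last exact: ltry.
apply: ge_ereal_sup => _ [y _ <-].
case E: (f y) => [r| |]; last by have := fNoo y; rewrite E.
  rewrite -EFinD lee_fin; have : f y <= r%:E by rewrite E.
  move/subgrad; rewrite /u !linearZr_LR linearBl /=; lra.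
by rewrite /= leNye.
Qed.

End Gamma0.
End Hilbert.

(** * Recession functions of proper functions *)

Section Recession.
Context (R : realType).

Lemma proper_fin (T : Type) (h : T -> \bar R) y :
  proper_fun h -> dom h y -> h y \is a fin_num.
Proof. by move=> [hoo _] hy; rewrite fin_numE hoo lt_eqF. Qed.

(** For real [c], the absence of [-oo] forces all elements of [A] and [B] to be finite, so each can
    be moved across the inequality before taking a supremum. *)
Lemma ereal_sup_addle (A B : set \bar R) (c : \bar R) :
  A !=set0 -> B !=set0 ->
  (forall a, A a -> a != -oo) -> (forall b, B b -> b != -oo) ->
  (forall a b, A a -> B b -> a + b <= c) ->
  ereal_sup A + ereal_sup B <= c.
Proof.
move=> [a0 Aa0] [b0 Bb0] Aoo Boo.
case: c => [c| |] leABc; first last.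
- have := leABc _ _ Aa0 Bb0; rewrite leeNy_eq => /eqP.
  have := Aoo _ Aa0; have := Boo _ Bb0.
  by case: (a0) (b0) => [?| |] [?| |].
- exact: leey.
have Afin a : A a -> a \is a fin_num.
  move=> Aa; have := leABc _ _ Aa Bb0; have := Aoo _ Aa; have := Boo _ Bb0.
  by case: a (b0) {Aa} => [?| |] [?| |].
have BlE a : A a -> ereal_sup B <= c%:E - a.
  move=> Aa; apply: ge_ereal_sup => b Bb.
  by rewrite leeBrDr ?Afin // addeC leABc.
have Bfin : ereal_sup B \is a fin_num.
  rewrite fin_numE; apply/andP; split.
    have := ereal_sup_ubound Bb0; have := Boo _ Bb0.
    by case: (ereal_sup B) => //; case: (b0).
  have := BlE _ Aa0; have := Afin _ Aa0.
  by case: (ereal_sup B) => //; case: (a0).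
rewrite -leeBrDr //; apply: ge_ereal_sup => a Aa.
by rewrite leeBrDr // addeC -leeBrDr ?BlE // Afin.
Qed.

Section Lmodule.
Context (E : lmodType R) (h : E -> \bar R).
Hypothesis hp : proper_fun h.

Lemma recession_ninfty x : recession h x != -oo.
Proof.
have [hoo [a ha]] := hp.
have : h (a + x)%R - h a <= recession h x by apply: ereal_sup_ubound; exists a.
have := hoo (a + x)%R; have := proper_fin hp ha.
by case: (recession h x) => //; case: (h a) => // r; case: (h _).
Qed.

Lemma recession0_ge0 : 0 <= recession h 0%R.
Proof.
have [_ [a ha]] := hp; apply: ereal_sup_ubound; exists a => //.
by rewrite addr0 subee // proper_fin.
Qed.

(** The bound reached after [n] steps is finite, so the point is still in [dom h] and the recession
    inequality applies there again. *)
Lemma recession_iter a x (c r : R) (n : nat) :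
  h a <= c%:E -> recession h x <= r%:E ->
  h (a + n%:R *: x)%R <= (c + n%:R * r)%:E.
Proof.
move=> hac hxr; elim: n => [|n IH]; first by rewrite scale0r addr0 mul0r addr0.
set z := (a + n%:R *: x)%R in IH.
have dz : dom h z by apply: le_lt_trans IH _; exact: ltry.
have : h (z + x)%R - h z <= r%:E.
  by apply: le_trans hxr; apply: ereal_sup_ubound; exists z.
rewrite leeBlDr ?proper_fin // => hz.
have -> : (a + n.+1%:R *: x = z + x)%R.
  by rewrite /z -addrA -[X in (_ + (_ + X))%R]scale1r -scalerDl natr1.
apply: (le_trans hz); apply: (le_trans (leeD2l r%:E IH)).
by rewrite -EFinD lee_fin -natr1; lra.
Qed.

End Lmodule.

Lemma proper_opp (E : lmodType R) (h : E -> \bar R) :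
  proper_fun h -> proper_fun (fun y => h (- y)%R).
Proof. by move=> [hoo [a ha]]; split=> //; exists (- a)%R; rewrite /dom/= opprK. Qed.

Lemma recession_opp (E : lmodType R) (h : E -> \bar R) x :
  recession (fun y => h (- y)%R) x = recession h (- x)%R.
Proof.
congr ereal_sup; apply/seteqP; split=> _ [y hy <-]; exists (- y)%R => //.
- by rewrite opprD.
- by rewrite /dom/= opprK.
- by rewrite opprD !opprK.
Qed.

(** Points of [dom h] and [dom k] can be chosen independently, and the increments at such a pair add
    up. *)
Lemma recession_sum_ge (E : lmodType R) (h k : E -> \bar R) x u :
  proper_fun h -> proper_fun k ->
  recession h x + recession k u <=
  recession (fun p : E * E => h p.1 + k p.2) (x, u).
Proof.
move=> hp kp; have [hoo [a ha]] := hp; have [koo [b kb]] := kp.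
apply: ereal_sup_addle.
- by exists (h (a + x)%R - h a); exists a.
- by exists (k (b + u)%R - k b); exists b.
- move=> _ [y hy <-]; have := proper_fin hp hy; have := hoo (y + x)%R.
  by case: (h y) (h _) => [?| |] [?| |].
- move=> _ [y ky <-]; have := proper_fin kp ky; have := koo (y + u)%R.
  by case: (k y) (k _) => [?| |] [?| |].
move=> _ _ [y hy <-] [z kz <-].
apply: ereal_sup_ubound; exists (y, z) => /=.
  by rewrite /dom/= lte_add_pinfty.
by rewrite addeACA fin_num_oppeD // proper_fin.
Qed.

End Recession.

(** * Conjugates, and separation of domains by recession functions *)

Section Duality.
Context (R : realType) (H : normedModType R) (ip : {dot H for idfun}).

Lemma conjugate_ninfty (h : H -> \bar R) u :
  proper_fun h -> conjugate ip h u != -oo.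
Proof.
move=> hp; have [_ [a ha]] := hp.
have : (ip a u)%:E - h a <= conjugate ip h u by apply: ereal_sup_ubound; exists a.
have := proper_fin hp ha.
by case: (h a) => // r _; case: (conjugate _ _ _).
Qed.

Lemma fenchel_young (h : H -> \bar R) y u : proper_fun h ->
  (ip y u)%:E <= h y + conjugate ip h u.
Proof.
move=> hp; have [hoo _] := hp.
have : (ip y u)%:E - h y <= conjugate ip h u by apply: ereal_sup_ubound; exists y.
have := conjugate_ninfty u hp; have := hoo y.
case: (h y) => [r| |] // _ cu; last by rewrite addye ?leey.
by rewrite leeBlDr // addeC.
Qed.

(* Dividing the pairing inequality at [(a + n x, mu)] by [n] and letting [n]
   grow bounds the support function of [dom k] by the recession function of [h]. *)
Lemma dom_le_recession (h k : H -> \bar R) x mu (r : R) :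
  proper_fun h -> (forall y u, (ip u y)%:E <= h y + k u) ->
  recession h x <= r%:E -> dom k mu -> (ip mu x <= r)%R.
Proof.
move=> hp pairing hxr kmu; have [_ [a ha]] := hp.
have [c hc] : exists c : R, h a <= c%:E.
  by exists (fine (h a)); rewrite fineK // proper_fin.
have [d kd] : exists d : R, k mu <= d%:E.
  move: kmu; rewrite /dom/=; case: (k mu) => [d| |] // _; first by exists d.
  by exists 0%R; rewrite leNye.
rewrite leNgt; apply/negP => ltr.
pose e := (ip mu x - r)%R.
have e0 : (0 < e)%R by rewrite subr_gt0.
(* With this [N], the gain [N * e] exceeds [c + d - ip mu a], against the pairing inequality at
   [a + N x]. *)
pose N := Num.bound `|(c + d - ip mu a) / e|%R.
have : (c + d - ip mu a < N%:R * e)%R.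
  rewrite -ltr_pdivrMr //; apply: (le_lt_trans (ler_norm _)).
  by rewrite archi_boundP.
have := pairing (a + N%:R *: x)%R mu.
move=> /le_trans/(_ (leeD (recession_iter hp N hc hxr) kd)).
rewrite -EFinD lee_fin linearDr linearZr_LR /= /e; lra.
Qed.

Lemma strong_separation (C D : set H) u (r1 r2 : R) :
  (r1 + r2 < 0)%R -> u != 0%R ->
  (forall y, C y -> (ip y u <= r1)%R) -> (forall z, D z -> (- r2 <= ip z u)%R) ->
  [/\ ereal_sup [set (ip y u)%:E | y in C] < ereal_inf [set (ip z u)%:E | z in D],
      strongly_separated ip u C D & C `&` D = set0].
Proof.
move=> r12 u0 Cr1 Dr2.
have supC : ereal_sup [set (ip y u)%:E | y in C] <= r1%:E.
  by apply: ge_ereal_sup => _ [y Cy <-]; rewrite lee_fin Cr1.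
have infD : (- r2)%:E <= ereal_inf [set (ip z u)%:E | z in D].
  by apply: le_ereal_inf_tmp => _ [z Dz <-]; rewrite lee_fin Dr2.
split.
- apply: (le_lt_trans supC); apply: lt_le_trans infD; rewrite lte_fin; lra.
(* The level is the midpoint of [r1] and [- r2]. *)
- split=> //; exists ((r1 - r2) / 2)%R; split.
    by apply: (le_lt_trans supC); rewrite lte_fin; lra.
  by apply: lt_le_trans infD; rewrite lte_fin; lra.
- apply/seteqP; split=> // y [/Cr1 ? /Dr2 ?]; lra.
Qed.

(* Both infeasibility certificates are instances: one has [w = - u] and
   [D = dom k2], the other [w = u] and [D = - dom k2]. *)
Lemma recession_separation (h1 h2 k1 k2 : H -> \bar R) u w (D : set H) :
  proper_fun h1 -> proper_fun h2 ->
  (forall y v, (ip v y)%:E <= h1 y + k1 v) ->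
  (forall y v, (ip v y)%:E <= h2 y + k2 v) ->
  (u = 0%R -> w = 0%R) ->
  (forall z, D z -> exists2 v, dom k2 v & (ip z u = - ip v w)%R) ->
  recession h1 u + recession h2 w < 0 ->
  [/\ ereal_sup [set (ip y u)%:E | y in dom k1] <
        ereal_inf [set (ip z u)%:E | z in D],
      strongly_separated ip u (dom k1) D & dom k1 `&` D = set0].
Proof.
move=> p1 p2 pair1 pair2 uw0 Dk2 rec0.
have u0 : u != 0%R.
  apply/eqP => u0; move: rec0; rewrite (uw0 u0) u0 ltNge.
  by rewrite adde_ge0 // recession0_ge0.
(* Neither term is [-oo], so a negative sum makes both finite. *)
move: rec0 (recession_ninfty p1 u) (recession_ninfty p2 w).
case E1: (recession h1 u) => [r1| |] //; case E2: (recession h2 w) => [r2| |] //.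
rewrite -EFinD lte_fin => r12 _ _.
apply: (strong_separation r12 u0).
  by move=> y; apply: dom_le_recession pair1 _; rewrite ?E1.
move=> z /Dk2[v k2v ->]; rewrite lerN2.
by apply: dom_le_recession pair2 _ k2v; rewrite ?E2.
Qed.

End Duality.

Theorem mainTheorem1 (R : realType) (H : completeNormedModType R)
    (ip : {dot H for idfun}) (hip : induces_norm ip)
    (f g : H -> \bar R) (hf : Gamma0 f) (hg : Gamma0 g) :
  let f' := conjugate ip f in
  let g' := conjugate ip g in
  let primal := fun y : H => f y + g y in
  let dual := fun mu : H => - f' mu - g' (- mu)%R in
  let F := fun p : H * H => f p.1 + f' p.2 in
  let G := fun p : H * H => g p.1 + g' (- p.2)%R in
  let dom_opp_g' := [set (- mu)%R | mu in dom g'] in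
  forall strong_duality :
    ereal_inf [set primal y | y in [set: H]] =
    ereal_sup [set dual mu | mu in [set: H]],
  forall (x nu : H) (tau : R), (0 <= tau)%R ->
  let lhs := perspective F ((x, nu), tau) + perspective G ((x, nu), tau) in
  lhs <= 0 ->
  let cond_a := recession f' nu + recession g' (- nu)%R < 0 in
  let cond_b := recession f x + recession g x < 0 in
  [/\ (0 < tau)%R ->
        let xt := (tau^-1 *: x)%R in
        let nut := (tau^-1 *: nu)%R in
        [/\ lhs = 0,
            is_minimizer primal xt /\ (dom f `&` dom g) xt,
            is_maximizer dual nut /\ (dom f' `&` dom_opp_g') nut &
            f xt + g xt + f' nut + g' (- nut)%R = 0],
      lhs < 0 -> tau = 0%R /\ (cond_a \/ cond_b),
      cond_a ->
        [/\ ereal_sup [set (ip u nu)%:E | u in dom f] <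
              ereal_inf [set (ip z nu)%:E | z in dom g],
            strongly_separated ip nu (dom f) (dom g) &
            dom f `&` dom g = set0] &
      cond_b ->
        [/\ ereal_sup [set (ip mu x)%:E | mu in dom f'] <
              ereal_inf [set (ip lambda x)%:E | lambda in dom_opp_g'],
            strongly_separated ip x (dom f') dom_opp_g' &
            dom f' `&` dom_opp_g' = set0]].
Proof.
move=> f' g' primal dual F G dom_opp_g' _ x nu tau tau0 lhs lhs0 cond_a cond_b.
have [pf _ _] := hf; have [pg _ _] := hg.
have pf' : proper_fun f'.
  by split=> [u|]; [exact: conjugate_ninfty|exact: conjugate_dom_neq0].
have pg' : proper_fun g'.
  by split=> [u|]; [exact: conjugate_ninfty|exact: conjugate_dom_neq0].
have fyf y u : (ip y u)%:E <= f y + f' u by exact: fenchel_young.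
have fyg y u : (ip y u)%:E <= g y + g' u by exact: fenchel_young.
have weak y u : 0 <= f y + g y + (f' u + g' (- u)%R).
  rewrite addeACA; apply: le_trans (leeD (fyf y u) (fyg y (- u)%R)).
  by rewrite linearNr -EFinD subrr.
have opt : (0 < tau)%R ->
    let xt := (tau^-1 *: x)%R in let nut := (tau^-1 *: nu)%R in
    [/\ lhs = 0, is_minimizer primal xt /\ (dom f `&` dom g) xt,
        is_maximizer dual nut /\ (dom f' `&` dom_opp_g') nut &
        f xt + g xt + f' nut + g' (- nut)%R = 0].
  move=> t0 xt nut.
  have lhsE : lhs = tau%:E * (f xt + g xt + (f' nut + g' (- nut)%R)).
    rewrite /lhs /perspective /= t0 /F /G /= -/xt -/nut addeACA [RHS]muleDr //.
    (* Distributivity requires that no opposite infinities meet, which holds since none of the four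
       values is [-oo]. *)
    move: (pf.1 xt) (pg.1 xt) (pf'.1 nut) (pg'.1 (- nut)%R).
    by case: (f xt) (g xt) (f' nut) (g' _) => [?| |] [?| |] [?| |] [?| |].
  have gap0 : f xt + g xt + (f' nut + g' (- nut)%R) = 0.
    apply/eqP; rewrite eq_le weak andbT.
    by move: lhs0; rewrite lhsE pmule_rle0 ?lte_fin.
  have := gap0; have := pf.1 xt; have := pg.1 xt.
  have := pf'.1 nut; have := pg'.1 (- nut)%R.
  (* A zero sum without [-oo] has only finite terms, so the real case alone survives. *)
  case Ef: (f xt) => [a| |]; case Eg: (g xt) => [b| |];
    case Ef': (f' nut) => [c| |]; case Eg': (g' (- nut)%R) => [d| |] // _ _ _ _.
  rewrite -!EFinD => -[abcd0]; split.
  - by rewrite lhsE gap0 mule0.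
  - split; last by split; rewrite /dom/= ?Ef ?Eg ltry.
    move=> y; rewrite /primal Ef Eg.
    (* Weak duality against the fixed [nut] bounds the primal value below by [- (c + d)], which
       equals [a + b]; the dual case fixes [xt] instead. *)
    have := weak y nut; rewrite Ef' Eg' -EFinD.
    rewrite -leeBlDr // add0e => /(le_trans _); apply.
    by rewrite -!EFinD -EFinN lee_fin; lra.
  - split; last first.
      split; first by rewrite /dom/= Ef' ltry.
      by exists (- nut)%R; rewrite ?opprK // /dom/= Eg' ltry.
    move=> u; rewrite /dual Ef' Eg'.
    have := weak xt u; rewrite Ef Eg -EFinD.
    have := pf'.1 u; have := pg'.1 (- u)%R.
    case: (f' u) (g' (- u)%R) => [c'| |] [d'| |] // _ _; rewrite ?leNye //=.
    by rewrite !lee_fin; lra.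
  - by congr EFin; lra.
split=> //.
- move=> ltlhs0.
  have t0 : tau = 0%R.
    apply/eqP; move: tau0; rewrite le_eqVlt => /orP[/eqP <- //|/opt[lhsE]].
    by move: ltlhs0; rewrite lhsE ltxx.
  split=> //; apply: contrapT => /not_orP[/negP]; rewrite -leNgt => a0 /negP.
  rewrite -leNgt => b0; move: ltlhs0; apply/negP; rewrite -leNgt.
  apply: (le_trans (adde_ge0 b0 a0)).
  rewrite addeACA /lhs /perspective /= t0 ltxx eqxx.
  apply: leeD; first exact: recession_sum_ge.
  by rewrite -recession_opp; apply: recession_sum_ge => //; exact: proper_opp.
(* For (a) the conjugates supply the recession functions and [f], [g] the domains; for (b) the roles
   are exchanged. Both rest on the same Fenchel-Young inequalities. *)
- apply: (@recession_separation _ _ ip f' g' f g) => //.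
  + by move=> y v; rewrite addeC.
  + by move=> y v; rewrite addeC.
  + by move=> ->; rewrite oppr0.
  + by move=> z gz; exists z => //; rewrite linearNr opprK.
- apply: (@recession_separation _ _ ip f g f' g') => //.
  + by move=> y v; rewrite dotC.
  + by move=> y v; rewrite dotC.
  + by move=> _ [v gv <-]; exists v => //; rewrite linearNl.
Qed.
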